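(* There exists a function $\tilde g:\mathbb{R}_+\to\mathbb{R}_+$, where $\mathbb{R}_+=[0,\infty)$, such that for any two i.i.d. pairs $(X,Y)$ and $(X',Y')$ of $\mathbb{Z}$-valued random variables with $H(X|Y)<\infty$, $$H(X+X'|Y,Y')-H(X|Y)\ \geq\ \tilde g(H(X|Y)).$$ Moreover, $\tilde g$ is an increasing function, and $\tilde g(c)=0$ if and only if $c=0$.
   Context: $H(\cdot)$ is Shannon entropy in bits (base-2 logarithm) and $H(X|Y)=\sum_{y}\mathbb{P}(Y=y)H(X|Y=y)$ is the conditional entropy. ''i.i.d. pairs'' means that $(X,Y)$ and $(X',Y')$ are independent of each other and have the same joint distribution ($X$ and $Y$ need not be independent). ''Increasing'' is meant in the monotone sense: $c\le c'$ implies $\tilde g(c)\le\tilde g(c')$. The function $\tilde g$ is universal: it does not depend on the joint distribution. *)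

(* Defs.v *)
From HB Require Import structures.
From mathcomp Require Import all_boot all_order all_algebra.
From mathcomp Require Import all_classical all_reals all_analysis.

Set Implicit Arguments.
Unset Strict Implicit.
Unset Printing Implicit Defensive.

Import Order.TTheory GRing.Theory Num.Theory.

Local Open Scope classical_set_scope.
Local Open Scope ring_scope.

HB.instance Definition _ := isPointed.Build int 0.

HB.instance Definition _ := @isMeasurable.Build default_measure_display
  int discrete_measurable discrete_measurable0
  discrete_measurableC discrete_measurableU.

Definition log2 (R : realType) (x : R) : R := ln x / ln 2.

(* Since [ln 0 = 0], the convention 0 log 0 = 0 holds automatically. *)
Definition entropy_pmf (R : realType) (I : choiceType) (p : I -> R) : \bar R :=
  (\esum_(i in [set: I]) (- (p i * log2 (p i)))%:E)%E.

(* P(X = x | Y = y); identically 0 in x when P(Y = y) = 0, as division by 0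
   returns 0. *)
Definition cond_pmf d (T : measurableType d) (R : realType)
    (P : probability T R) (I J : choiceType) (X : T -> I) (Y : T -> J)
    (y : J) (x : I) : R :=
  fine (P (X @^-1` [set x] `&` Y @^-1` [set y])) / fine (P (Y @^-1` [set y])).

(* H(X|Y) = sum_y P(Y = y) H(X | Y = y), possibly +oo *)
Definition cond_entropy d (T : measurableType d) (R : realType)
    (P : probability T R) (I J : choiceType) (X : T -> I) (Y : T -> J) :
    \bar R :=
  (\esum_(y in [set: J]) (P (Y @^-1` [set y]) * entropy_pmf (cond_pmf P X Y y)))%E.

Definition identically_distributed d d' (T : measurableType d)
    (U : measurableType d') (R : realType) (P : probability T R)
    (Z Z' : T -> U) : Prop :=
  forall A : set U, measurable A -> P (Z @^-1` A) = P (Z' @^-1` A).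

Definition independent_rv d d' (T : measurableType d)
    (U : measurableType d') (R : realType) (P : probability T R)
    (Z Z' : T -> U) : Prop :=
  forall A B : set U, measurable A -> measurable B ->
    P (Z @^-1` A `&` Z' @^-1` B) = (P (Z @^-1` A) * P (Z' @^-1` B))%E.

(* Main.v *)
(** Let p, q be the laws of two independent variables and r = p * q. The gain
    H(r) - H(p) is the q-average of the divergences D(p(. - i) || r), and
    symmetrically for H(r) - H(q).

    If q has an atom of mass >= 1 - b, conditioning on that atom gives
    H(r) >= (1 - b) H(p) + H(q) - h(b), with h the binary entropy; for b small
    with respect to c <= H(p), H(q) this exceeds the mean entropy by a multiple
    of c.  If all atoms of q are <= 1 - b, let l < u be its b/2-quantiles.  If
    some interval of length u - l carries p-mass >= 1/8, then the shifts of p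
    by i <= l and by i >= u have distant distribution functions, so one of the
    two families is far from r.  Otherwise r gives mass <= 1/4 to every
    translate of [l, u], while q([l, u]) >= 3/4, so every shift of q is far
    from r.

    For the conditional statement, let h be the entropy of X given Y, of mean c.
    If h >= c/2 with probability >= 1/2, integrate the gap above; otherwise,
    max(h, h') >= h 1_{h >= c/2} + h' 1_{h < c/2} already gains c/4. *)

Require Import Defs.
From HB Require Import structures.
From mathcomp Require Import all_boot all_order all_algebra.
From mathcomp Require Import all_classical all_reals all_analysis.
From mathcomp Require Import ring lra zify.

Import Order.TTheory GRing.Theory Num.Theory.

Local Open Scope classical_set_scope.
Local Open Scope ring_scope.

Set Implicit Arguments.
Unset Strict Implicit.
Unset Printing Implicit Defensive.

(** * Sums of nonnegative extended reals over arbitrary index types *)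

Section nonneg_esum.
Context (R : realType).
Local Open Scope ereal_scope.

Lemma ge0_esumZl (I : choiceType) (D : set I) (k : R) (f : I -> \bar R) :
  (0 <= k)%R -> (forall i, 0 <= f i) ->
  \esum_(i in D) (k%:E * f i) = k%:E * \esum_(i in D) f i.
Proof.
move=> k0 f0; rewrite /esum -ereal_supZl//; last first.
  apply/set0P; exists 0; exists set0; first exact: fsets_set0.
  by rewrite fsbig_set0.
rewrite image_comp; congr ereal_sup; apply: eq_imagel => X _ /=.
by rewrite ge0_mule_fsumr.
Qed.

Lemma esum_swap (I J : choiceType) (D : set I) (E : set J) (f : I -> J -> \bar R) :
  (forall i j, 0 <= f i j) ->
  \esum_(i in D) \esum_(j in E) f i j = \esum_(j in E) \esum_(i in D) f i j.
Proof.
move=> f0; rewrite !esum_esum//.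
rewrite (reindex_esum (E `*`` (fun=> D)) _ (fun x => (x.2, x.1)))//.
split=> [[j i] []//|[j1 i1] [j2 i2] _ _ [-> ->]//|[i j] [/= Di Ej]].
by exists (j, i).
Qed.

Lemma esum_ge1 (I : choiceType) (D : set I) (f : I -> \bar R) i :
  (forall i, 0 <= f i) -> D i -> f i <= \esum_(i in D) f i.
Proof.
move=> f0 Di; apply: esum_ge; exists [set i]; last by rewrite fsbig_set1.
by split => // _ ->.
Qed.

Lemma le_esum_subset (I : choiceType) (A B : set I) (f : I -> \bar R) :
  (forall i, 0 <= f i) -> A `<=` B ->
  \esum_(i in A) f i <= \esum_(i in B) f i.
Proof.
move=> f0 AB; rewrite esum_mkcond [leRHS]esum_mkcond; apply: le_esum => i _.
case: ifPn => [/set_mem/AB/mem_set->//|_]; by case: ifPn.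
Qed.

Lemma esum_shift (k : int) (f : int -> \bar R) :
  \esum_(n in setT) f n = \esum_(n in setT) f (k + n)%R.
Proof.
by apply: reindex_esum; split.
Qed.

Lemma esum_opp (f : int -> \bar R) :
  \esum_(n in setT) f n = \esum_(n in setT) f (- n)%R.
Proof.
by apply: reindex_esum; split.
Qed.

End nonneg_esum.

(** * Probability mass functions and the mass of a set *)

Section pmf.
Context (R : realType).

Definition is_pmf (I : choiceType) (p : I -> R) : Prop :=
  (forall i, 0 <= p i) /\ (\esum_(i in setT) (p i)%:E = 1)%E.

Definition mass (I : choiceType) (p : I -> R) (A : set I) : R :=
  fine (\esum_(i in A) (p i)%:E)%E.

Context (I : choiceType) (p : I -> R).
Hypothesis pp : is_pmf p.
Implicit Types A B : set I.

Lemma is_pmf_ge0 i : 0 <= p i. Proof. by case: pp. Qed.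

Lemma is_pmf_ge0e i : (0 <= (p i)%:E)%E. Proof. by rewrite lee_fin is_pmf_ge0. Qed.
Local Hint Resolve is_pmf_ge0 is_pmf_ge0e : core.

Lemma massE A : (mass p A)%:E = (\esum_(i in A) (p i)%:E)%E.
Proof.
rewrite fineK// ge0_fin_numE ?esum_ge0//.
by rewrite (@le_lt_trans _ _ 1%E) ?ltry//; case: pp => _ <-; exact: le_esum_subset.
Qed.

Lemma mass_ge0 A : 0 <= mass p A.
Proof. by rewrite -lee_fin massE esum_ge0. Qed.

Lemma massT : mass p setT = 1.
Proof. by apply: EFin_inj; rewrite massE; case: pp. Qed.

Lemma le_mass A B : A `<=` B -> mass p A <= mass p B.
Proof. by move=> AB; rewrite -lee_fin !massE le_esum_subset. Qed.

Lemma mass_le1 A : mass p A <= 1.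
Proof. by rewrite -massT le_mass. Qed.

Lemma mass1 i : mass p [set i] = p i.
Proof. by apply: EFin_inj; rewrite massE esum_set1. Qed.

Lemma is_pmf_le1 i : p i <= 1.
Proof. by rewrite -mass1 mass_le1. Qed.

Lemma massID A B : mass p A = mass p (A `&` B) + mass p (A `&` ~` B).
Proof. by apply: EFin_inj; rewrite EFinD !massE (esumID B). Qed.

Lemma massC A : mass p (~` A) = 1 - mass p A.
Proof. by rewrite -massT (massID setT A) !setTI addrAC subrr add0r. Qed.

Lemma le_massU A B : mass p (A `|` B) <= mass p A + mass p B.
Proof.
rewrite (massID _ A) setUK lerD2l le_mass// => i [[]]//.
Qed.

(** The two sign conditions say that both values [a] and [a + b] are nonnegative, so the sum may be
    split over [A] and its complement. *)
Lemma esum_affine_indic (a b : R) A : 0 <= a -> 0 <= a + b ->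
  (\esum_(i in setT) (p i * (a + b * (i \in A)%:R))%:E = (a + b * mass p A)%:E)%E.
Proof.
move=> a0 ab0; rewrite (esumID A); last first.
  by move=> i _; rewrite lee_fin mulr_ge0//; case: (i \in A); rewrite ?mulr1 ?mulr0 ?addr0.
rewrite !setTI.
rewrite [X in (X + _)%E](_ : _ = (a + b)%:E * \esum_(i in A) (p i)%:E)%E; last first.
  rewrite -ge0_esumZl//; apply: eq_esum => i Ai.
  by rewrite -EFinM mem_set// mulr1 mulrC.
rewrite [X in (_ + X)%E](_ : _ = a%:E * \esum_(i in ~` A) (p i)%:E)%E; last first.
  rewrite -ge0_esumZl//; apply: eq_esum => i Ai.
  by rewrite -EFinM memNset// mulr0 addr0 mulrC.
rewrite -!massE massC -!EFinM -EFinD; congr EFin; ring.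
Qed.

End pmf.

(** * Entropy in nats and a quantitative Gibbs inequality *)

Section entropy.
Context (R : realType) (I : choiceType).
Implicit Types s r : I -> R.

Definition ent s : \bar R := (\esum_(i in setT) (- (s i * ln (s i)))%:E)%E.

(** Cross-entropy, that is [ent s] plus the divergence D(s || r); its terms are nonnegative for mass
    functions, unlike those of the divergence. As [ln 0 = 0], points with [r i = 0] contribute 0
    instead of +oo, so the comparisons below assume that [s] vanishes where [r] does. *)
Definition xent s r : \bar R := (\esum_(i in setT) (- (s i * ln (r i)))%:E)%E.

Lemma xent_term_ge0 (x y : R) : 0 <= x -> y <= 1 -> 0 <= - (x * ln y).
Proof. by move=> x0 y1; rewrite oppr_ge0 mulr_ge0_le0 ?ln_le0. Qed.

(** Apply [ln u <= u - 1] to [u = r * (1 + x) / s], then bound [ln (1 + x)] below by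
    [x - 2 * x ^+ 2], which uses [- (1 / 2) <= x]. The terms are distributed so that each one is
    nonnegative and can be summed separately. *)
Lemma gibbs_pointwise (s r x : R) : 0 <= s -> 0 <= r -> (r = 0 -> s = 0) ->
  - (1 / 2) <= x ->
  - (s * ln s) + s * (1 + x) <=
  - (s * ln r) + (r * (1 + x) + s * (2 * x ^+ 2)).
Proof.
rewrite le_eqVlt => /predU1P[<-|s0].
  by move=> r0 _ x2; rewrite !mul0r oppr0 !addr0 add0r; nra.
rewrite le_eqVlt => /predU1P[<- /(_ erefl) s0'|r0 _ x2].
  by rewrite s0' ltxx in s0.
have x1 : 0 < 1 + x by lra.
have l1 : ln (r * (1 + x) / s) <= r * (1 + x) / s - 1.
  rewrite -[X in ln X](subrK 1) addrC le_ln1Dx//.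
  have : 0 < r * (1 + x) / s by rewrite !mulr_gt0 ?invr_gt0.
  by lra.
have l2 : ln (1 + x)^-1 <= (1 + x)^-1 - 1.
  rewrite -[X in ln X](subrK 1) addrC le_ln1Dx//.
  have : 0 < (1 + x)^-1 by rewrite invr_gt0.
  by lra.
rewrite ln_div ?posrE ?mulr_gt0// lnM ?posrE// in l1.
rewrite lnV ?posrE// in l2.
have l3 : (1 + x)^-1 - 1 <= - x + 2 * x ^+ 2.
  rewrite lerBlDr -[(1+x)^-1]mul1r ler_pdivrMr//; nra.
have l4 : ln r + (x - 2 * x ^+ 2) - ln s <= r * (1 + x) / s - 1 by lra.
have : s * (ln r + (x - 2 * x ^+ 2) - ln s) <= s * (r * (1 + x) / s - 1).
  by rewrite ler_pM2l.
have -> : s * (r * (1 + x) / s - 1) = r * (1 + x) - s by field; lra.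
lra.
Qed.

(* Gibbs' inequality against [r] tilted by the factor
   [1 + (s(A) - r(A)) / 4 * (1_A - r(A))], which has total mass 1. *)
Lemma gibbs_mass s r (A : set I) : is_pmf s -> is_pmf r ->
  (forall i, r i = 0 -> s i = 0) ->
  (ent s + ((mass s A - mass r A) ^+ 2 / 8)%:E <= xent s r)%E.
Proof.
move=> ps pr sr.
(* A tilt of size [l] gains [l * d - 2 * l ^+ 2]; this is largest at [l = d / 4], with value
   [d ^+ 2 / 8]. *)
set d := mass s A - mass r A; pose l := d / 4.
have := mass_ge0 ps A; have := mass_le1 ps A.
have := mass_ge0 pr A; have := mass_le1 pr A => r1 r0 s1 s0.
have dl : d = 4 * l by rewrite /l; field.
have lb : - (1/4) <= l <= 1/4 by move: dl; rewrite /d; lra.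
pose x i : R := - (l * mass r A) + l * (i \in A)%:R.
have xb i : - (1/4) <= x i <= 1/4.
  have [lb1 lb2] := andP lb.
  have m1 : 0 <= (1/4 - l) * mass r A by rewrite mulr_ge0 ?subr_ge0.
  have m2 : 0 <= (1/4 + l) * mass r A by rewrite mulr_ge0//; lra.
  have m3 : 0 <= (1/4 - l) * (1 - mass r A) by rewrite mulr_ge0 ?subr_ge0.
  have m4 : 0 <= (1/4 + l) * (1 - mass r A) by rewrite mulr_ge0 ?subr_ge0//; lra.
  by rewrite /x; case: (i \in A); rewrite ?mulr1 ?mulr0 ?addr0; lra.
have xl i : x i ^+ 2 <= l ^+ 2.
  have -> : x i = l * ((i \in A)%:R - mass r A) by rewrite /x; ring.
  rewrite exprMn ler_piMr ?sqr_ge0//.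
  case: (i \in A); rewrite /= ?mulr1n ?mulr0n; nra.
have key : (\esum_(i in setT) ((- (s i * ln (s i)))%:E + (s i * (1 + x i))%:E) <=
   \esum_(i in setT) ((- (s i * ln (r i)))%:E +
     ((r i * (1 + x i))%:E + (s i * (2 * l ^+ 2))%:E)))%E.
  apply: le_esum => i _; rewrite -!EFinD lee_fin.
  have := @gibbs_pointwise (s i) (r i) (x i) (is_pmf_ge0 ps i) (is_pmf_ge0 pr i) (@sr i).
  move=> /(_ _)/le_trans; apply; first by have := xb i; lra.
  by rewrite !lerD2l ler_wpM2l ?(is_pmf_ge0 ps)//; have := xl i; lra.
have xx1 i : 1 + x i = (1 - l * mass r A) + l * (i \in A)%:R by rewrite /x; ring.
have x1_ge0 i : 0 <= 1 + x i by have := xb i; lra.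
have s_ge0 i := is_pmf_ge0 ps i; have r_ge0 i := is_pmf_ge0 pr i.
have s1E i : (0 <= (s i * (1 + x i))%:E)%E by rewrite lee_fin mulr_ge0.
have r1E i : (0 <= (r i * (1 + x i))%:E)%E by rewrite lee_fin mulr_ge0.
have slE i : (0 <= (s i * (2 * l ^+ 2))%:E)%E.
  by rewrite lee_fin mulr_ge0// mulr_ge0// sqr_ge0.
have ssE i : (0 <= (- (s i * ln (s i)))%:E)%E.
  by rewrite lee_fin xent_term_ge0 ?(is_pmf_le1 ps).
have srE i : (0 <= (- (s i * ln (r i)))%:E)%E.
  by rewrite lee_fin xent_term_ge0 ?(is_pmf_le1 pr).
move: key; rewrite !esumD//; last by move=> i _; exact: adde_ge0.
under [X in (_ + X <= _)%E]eq_esum do rewrite xx1.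
under [X in (_ <= _ + (X + _))%E]eq_esum do rewrite xx1.
rewrite !esum_affine_indic//; [|nra..].
have -> : (\esum_(i in setT) (s i * (2 * l ^+ 2))%:E = (2 * l ^+ 2)%:E)%E.
  under eq_esum do rewrite mulrC EFinM.
  have l2 : 0 <= 2 * l ^+ 2 by rewrite mulr_ge0// sqr_ge0.
  by rewrite ge0_esumZl// (proj2 ps) mule1.
rewrite -/(ent s) -/(xent s r) -EFinD -leeBlDr// -addeA -EFinB; apply: le_trans.
rewrite leeD2l// lee_fin dl.
have -> : mass s A = mass r A + 4 * l by rewrite -dl /d; ring.
nra.
Qed.

Lemma gibbs s r : is_pmf s -> is_pmf r -> (forall i, r i = 0 -> s i = 0) ->
  (ent s <= xent s r)%E.
Proof.
move=> ps pr sr; apply: le_trans (gibbs_mass set0 ps pr sr).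
by rewrite leeDl// lee_fin mulr_ge0 ?sqr_ge0// invr_ge0.
Qed.

End entropy.

(** * Entropy of a convolution *)

Section convolution.
Context (R : realType).
Implicit Types p q r : int -> R.

(** A relation rather than an operation, so that it applies directly to the conditional law of a sum
    of random variables. *)
Definition is_conv p q r : Prop :=
  forall n, ((r n)%:E = \esum_(i in setT) (q i * p (n - i))%:E)%E.

Lemma is_convC p q r : is_conv p q r -> is_conv q p r.
Proof.
move=> pqr n; rewrite pqr [LHS](esum_shift n) [LHS]esum_opp.
apply: eq_esum => i _ /=; have -> : n - (n - i) = i by ring.
by rewrite mulrC.
Qed.

Lemma is_pmf_shift p k : is_pmf p -> is_pmf (fun j => p (k + j)).
Proof. by move=> [p0 p1]; split=> [//|]; rewrite -p1 [RHS](esum_shift k). Qed.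

Section given_conv.
Variables p q r : int -> R.
Hypotheses (pp : is_pmf p) (pq : is_pmf q) (pqr : is_conv p q r).

Let p_ge0 i : 0 <= p i. Proof. exact: is_pmf_ge0. Qed.
Let q_ge0 i : 0 <= q i. Proof. exact: is_pmf_ge0. Qed.
Let p_ge0E i : (0 <= (p i)%:E)%E. Proof. exact: is_pmf_ge0e. Qed.
Let q_ge0E i : (0 <= (q i)%:E)%E. Proof. exact: is_pmf_ge0e. Qed.

Lemma conv_ge0 n : 0 <= r n.
Proof. by rewrite -lee_fin pqr esum_ge0// => i _; rewrite lee_fin mulr_ge0. Qed.

Lemma conv_pmf : is_pmf r.
Proof.
split; first exact: conv_ge0.
under eq_esum do rewrite pqr.
rewrite esum_swap; last by move=> i j; rewrite lee_fin mulr_ge0.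
rewrite -(proj2 pq); apply: eq_esum => i _.
under eq_esum do rewrite EFinM.
rewrite ge0_esumZl// (esum_shift i).
under eq_esum do rewrite addrAC subrr add0r.
by rewrite (proj2 pp) mule1.
Qed.

(** [q i * p j] is one of the terms of [r (i + j)]. This is the absolute continuity that Gibbs'
    inequality asks for. *)
Lemma conv_support i j : 0 < q i -> r (i + j) = 0 -> p j = 0.
Proof.
move=> qi rij; apply/eqP; rewrite eq_le p_ge0 andbT -(@ler_pM2l _ (q i))// mulr0.
rewrite -rij -lee_fin pqr.
have := @esum_ge1 R _ setT (fun k => (q k * p (i + j - k))%:E) i.
by rewrite addrAC subrr add0r; apply=> // k; rewrite lee_fin mulr_ge0.
Qed.

(** Each mass under [r] is a [q]-average of masses under shifts of [p]. *)
Lemma conv_mass_le (B : set int) (c : R) :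
  (forall m, mass (fun k => p (m + k)) B <= c) ->
  forall j, mass (fun k => r (j + k)) B <= c.
Proof.
move=> pc j; rewrite -lee_fin massE; last exact/is_pmf_shift/conv_pmf.
under eq_esum do rewrite pqr.
rewrite esum_swap; last by move=> i k; rewrite lee_fin mulr_ge0.
apply: (@le_trans _ _ (\esum_(i in setT) (c%:E * (q i)%:E))%E).
  apply: le_esum => i _.
  under eq_esum do rewrite EFinM addrAC.
  rewrite ge0_esumZl// muleC lee_wpmul2r ?lee_fin//.
  by rewrite -massE ?lee_fin//; exact: is_pmf_shift.
rewrite ge0_esumZl// ?(proj2 pq) ?mule1//.
by apply: le_trans (pc 0); rewrite mass_ge0//; exact: is_pmf_shift.
Qed.

(** Expand only the factor [r n] outside the logarithm, exchange the sums and substitute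
    [n = i + j]. *)
Lemma conv_ent :
  (ent r = \esum_(i in setT) ((q i)%:E * xent p (fun j => (r (i + j))%R)))%E.
Proof.
have r1 n : 0 <= - ln (r n) by rewrite oppr_ge0 ln_le0// is_pmf_le1//; exact: conv_pmf.
transitivity (\esum_(n in setT) \esum_(i in setT) (q i * (- (p (n - i) * ln (r n))))%:E)%E.
  apply: eq_esum => n _; rewrite mulrC -mulNr EFinM pqr -ge0_esumZl//; last first.
    by move=> i; rewrite lee_fin mulr_ge0.
  by apply: eq_esum => i _; rewrite -EFinM; congr EFin; ring.
have h n m : 0 <= - (p m * ln (r n)) by rewrite -mulrN mulr_ge0.
have hE n m : (0 <= (- (p m * ln (r n)))%:E)%E by rewrite lee_fin.
rewrite esum_swap; last by move=> n i; rewrite lee_fin mulr_ge0.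
apply: eq_esum => i _; under eq_esum do rewrite EFinM.
rewrite ge0_esumZl//; congr (_ * _)%E; rewrite [LHS](esum_shift i).
by apply: eq_esum => j _ /=; rewrite addrAC subrr add0r.
Qed.

(** Apply [gibbs_mass] to the terms of [conv_ent] with [i] in [D], where the test set [A] may depend
    on [i], and plain Gibbs to the others. *)
Lemma conv_ent_gain (hp al eta : R) (D : set int) : ent p = hp%:E ->
  al <= mass q D ->
  (forall i, D i -> exists A,
     eta <= (mass p A - mass (fun j => r (i + j)) A) ^+ 2) ->
  0 <= eta ->
  ((hp + al * eta / 8)%:E <= ent r)%E.
Proof.
move=> php alD hD eta0.
have hp0 : 0 <= hp.
  by rewrite -lee_fin -php esum_ge0// => i _; rewrite lee_fin xent_term_ge0 ?is_pmf_le1.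
apply: (@le_trans _ _ (hp + eta / 8 * mass q D)%:E).
  by rewrite lee_fin; nra.
rewrite -(esum_affine_indic pq)//; last by rewrite addr_ge0// divr_ge0.
rewrite conv_ent; apply: le_esum => i _; rewrite EFinM.
move: (q_ge0 i); rewrite le_eqVlt => /predU1P[<-|qi]; first by rewrite !mul0e.
rewrite lee_pmul2l// EFinD -php.
have ac j : r (i + j) = 0 -> p j = 0 by exact: conv_support.
have pr : is_pmf (fun j => r (i + j)) by exact/is_pmf_shift/conv_pmf.
have [/set_mem/hD[A hA]|] := boolP (i \in D).
  apply: le_trans (gibbs_mass A pp pr ac); rewrite leeD2l// lee_fin mulr1.
  by rewrite ler_pM2r.
by move=> _; rewrite mulr0 adde0; exact: gibbs.
Qed.

Lemma conv_ent_ge (hp : R) : ent p = hp%:E -> (hp%:E <= ent r)%E.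
Proof.
move=> php; have := @conv_ent_gain hp 0 0 set0 php.
by rewrite mul0r mul0r addr0; apply=> //; exact: mass_ge0.
Qed.

End given_conv.

End convolution.

(** * The case of a law with a heavy atom *)

Section concentrated.
Context (R : realType).

(** With [- (x * ln x) <= 1 - x], the first term is at most [b], and writing [b = s ^+ 2] the second
    is at most [2 * s * (1 - s)]. *)
Lemma binary_entropy_le (b : R) : 0 <= b <= 1 ->
  - ((1 - b) * ln (1 - b)) - b * ln b <= 2 * Num.sqrt b.
Proof.
move=> /andP[b0 b1].
have aux (x : R) : 0 <= x -> - (x * ln x) <= 1 - x.
  rewrite le_eqVlt => /predU1P[<-|x0]; first by rewrite mul0r oppr0 addr0.
  have : ln x^-1 <= x^-1 - 1.
    rewrite -[X in ln X](subrK 1) addrC le_ln1Dx//.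
    by have := invr_gt0 x; rewrite x0; lra.
  rewrite lnV ?posrE// -(@ler_pM2l _ x)// mulrBr divff ?gt_eqF//; lra.
have h1 := aux (1 - b) ltac:(lra).
move: b0; rewrite le_eqVlt => /predU1P[b0|b0].
  by rewrite -b0 subr0 ln1 mulr0 mul0r subr0 oppr0 mulr_ge0 ?sqrtr_ge0.
have sb : b = Num.sqrt b ^+ 2 by rewrite sqr_sqrtr ?ltW.
have s0 : 0 < Num.sqrt b by rewrite sqrtr_gt0.
have h2 := aux (Num.sqrt b) (ltW s0).
have h3 : ln b = 2 * ln (Num.sqrt b) by rewrite {1}sb lnXn// mulr_natl.
have h4 : Num.sqrt b * (- (Num.sqrt b * ln (Num.sqrt b))) <= Num.sqrt b * (1 - Num.sqrt b).
  by rewrite ler_pM2l.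
rewrite h3 {3}sb; nra.
Qed.

(** Off [k], both [q] and [b * r] have mass at most [b = 1 - q k]; comparing them by [ln u <= u - 1]
    costs [- (b * ln b)]. The term of the atom completes this cost to the binary entropy of [b]. *)
Lemma ent_le_off_atom (I : choiceType) (q r : I -> R) (k : I) : is_pmf q -> is_pmf r ->
  (forall i, r i = 0 -> q i = 0) ->
  (ent q <= \esum_(i in ~` [set k]) (- (q i * ln (r i)))%:E +
            (2 * Num.sqrt (1 - q k))%:E)%E.
Proof.
move=> pq pr ac; set b := 1 - q k.
have q0 i := is_pmf_ge0 pq i; have q1 i := is_pmf_le1 pq i.
have r0 i := is_pmf_ge0 pr i; have r1 i := is_pmf_le1 pr i.
have b01 : 0 <= b <= 1 by rewrite /b; have := q0 k; have := q1 k; lra.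
have [b0 b1] := andP b01.
have mb : mass q (~` [set k]) = b by rewrite massC// mass1.
have key : (\esum_(i in ~` [set k]) ((- (q i * ln (q i)))%:E + (q i)%:E) <=
   \esum_(i in ~` [set k]) (((- (q i * ln (r i)))%:E + (- ln b)%:E * (q i)%:E) +
      b%:E * (r i)%:E))%E.
  apply: le_esum => i ik; rewrite -!EFinM -!EFinD lee_fin.
  have qb : q i <= b by rewrite -mb -(mass1 pq i) le_mass// => _ ->.
  have := q0 i; rewrite le_eqVlt => /predU1P[<-|qi].
    by rewrite !mul0r mulr0 !oppr0 !add0r mulr_ge0.
  have bp : 0 < b by exact: lt_le_trans qi qb.
  have ri : 0 < r i.
    by rewrite lt_neqAle eq_sym r0 andbT; apply/eqP => /ac qi0; rewrite qi0 ltxx in qi.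
  have : ln (b * r i / q i) <= b * r i / q i - 1.
    rewrite -[X in ln X](subrK 1) addrC le_ln1Dx//.
    have : 0 < b * r i / q i by rewrite !mulr_gt0 ?invr_gt0.
    by lra.
  rewrite ln_div ?posrE ?mulr_gt0// lnM ?posrE// => /(ler_wpM2l (ltW qi)).
  have -> : q i * (b * r i / q i - 1) = b * r i - q i by field; lra.
  lra.
have nlb : 0 <= - ln b by rewrite oppr_ge0 ln_le0.
have q0E i : (0 <= (q i)%:E)%E by rewrite lee_fin.
have r0E i : (0 <= (r i)%:E)%E by rewrite lee_fin.
have qqE i : (0 <= (- (q i * ln (q i)))%:E)%E by rewrite lee_fin xent_term_ge0.
have qrE i : (0 <= (- (q i * ln (r i)))%:E)%E by rewrite lee_fin xent_term_ge0.
have lqE i : (0 <= (- ln b)%:E * (q i)%:E)%E by rewrite lee_fin mulr_ge0.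
have brE i : (0 <= b%:E * (r i)%:E)%E by rewrite lee_fin mulr_ge0.
move: key; rewrite !esumD//; last by move=> i _; exact: adde_ge0.
rewrite !ge0_esumZl// -(massE pq) -(massE pr) mb => key.
rewrite /ent (esumID [set k])// !setTI esum_set1//.
have {key} : (\esum_(i in ~` [set k]) (- (q i * ln (q i)))%:E <=
    \esum_(i in ~` [set k]) (- (q i * ln (r i)))%:E + (- (b * ln b))%:E)%E.
  move: key; rewrite -leeBrDr// -!addeA -EFinM -EFinM -EFinB -EFinD.
  move=> /le_trans; apply; rewrite leeD2l// lee_fin.
  have := mass_le1 pr (~` [set k]); nra.
move=> /(leeD2l (- (q k * ln (q k)))%:E)/le_trans; apply.
rewrite addeCA leeD2l// -EFinD lee_fin.
have := binary_entropy_le b01; rewrite {1 2}/b.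
have -> : 1 - (1 - q k) = q k by ring.
lra.
Qed.

(** In [conv_ent], the term [i = k] is at least [q k * hp] by Gibbs. The other terms, summed over
    [i] first, form a [p]-average of off-atom cross-entropies of [q] against shifts of [r], to which
    [ent_le_off_atom] applies. *)
Lemma conv_ent_concentrated (p q r : int -> R) (hp hq : R) (k : int) :
  is_pmf p -> is_pmf q -> is_conv p q r -> ent p = hp%:E -> ent q = hq%:E ->
  ((q k * hp + hq)%:E <= ent r + (2 * Num.sqrt (1 - q k))%:E)%E.
Proof.
move=> pp pq pqr php phq; set e := 2 * _.
have p0 i := is_pmf_ge0 pp i; have q0 i := is_pmf_ge0 pq i.
have pr := conv_pmf pp pq pqr.
have rl n : 0 <= - ln (r n) by rewrite oppr_ge0 ln_le0// (is_pmf_le1 pr).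
have qprE i j : (0 <= (- (p j * ln (r (i + j))))%:E)%E.
  by rewrite lee_fin -mulrN mulr_ge0.
have xE i : (0 <= xent p (fun j => (r (i + j))%R))%E by rewrite esum_ge0.
have eE : (0 <= e%:E)%E by rewrite lee_fin mulr_ge0 ?sqrtr_ge0.
rewrite (conv_ent pp pq pqr) (esumID [set k]); last first.
  by move=> i _; rewrite mule_ge0 ?lee_fin.
rewrite !setTI esum_set1 ?mule_ge0 ?lee_fin// -addeA EFinD; apply: leeD.
  rewrite EFinM; have := q0 k; rewrite le_eqVlt => /predU1P[<-|qk].
    by rewrite !mul0e.
  rewrite lee_pmul2l// -php; apply: gibbs => //; first exact: is_pmf_shift.
  by move=> j; exact: (conv_support pp pq pqr qk).
apply: (@le_trans _ _ (\esum_(j in setT) ((p j)%:E *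
    (\esum_(i in ~` [set k]) (- (q i * ln (r (i + j))))%:E + e%:E)))%E).
  rewrite -[leLHS]mul1e -(proj2 pp) muleC -ge0_esumZl//; last first.
    by rewrite -lee_fin -phq esum_ge0// => i _; rewrite lee_fin xent_term_ge0 ?(is_pmf_le1 pq).
  apply: le_esum => j _; rewrite muleC.
  have := p0 j; rewrite le_eqVlt => /predU1P[<-|pj]; first by rewrite !mul0e.
  rewrite lee_pmul2l// -phq; apply: (ent_le_off_atom _ pq).
    have -> : (fun i => r (i + j)) = (fun i => r (j + i)).
      by apply/funext => i; rewrite addrC.
    exact: is_pmf_shift.
  by move=> i; rewrite addrC; exact: (conv_support pq pp (is_convC pqr) pj).
have qrE i j : (0 <= (- (q i * ln (r (i + j))))%:E)%E.
  by rewrite lee_fin -mulrN mulr_ge0.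
under eq_esum do rewrite ge0_muleDr// ?esum_ge0//.
rewrite esumD//; last 2 first.
  by move=> j _; rewrite mule_ge0 ?lee_fin ?esum_ge0.
  by move=> j _; rewrite mule_ge0 ?lee_fin.
apply: leeD; last first.
  under eq_esum do rewrite muleC.
  by rewrite ge0_esumZl// ?(proj2 pp) ?mule1// -lee_fin.
under eq_esum do rewrite -ge0_esumZl//.
rewrite esum_swap; last by move=> j i; rewrite mule_ge0 ?qrE ?lee_fin.
apply: le_esum => i _; rewrite /xent -ge0_esumZl//.
by apply: le_esum => j _; rewrite -!EFinM lee_fin; lra.
Qed.

End concentrated.

(** * The case of a law without a heavy atom *)

Section spread.
Context (R : realType).
Implicit Types p q r : int -> R.

Lemma mass_shift p (k : int) (A : set int) :
  mass (fun j => p (k + j)) A = mass p [set n | A (n - k)].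
Proof.
congr fine; symmetry; apply: (@reindex_esum _ _ _ _ _ (fun j => k + j)); split.
- by move=> j Aj /=; rewrite addrAC subrr add0r.
- by move=> i j _ _ /addrI.
- by move=> n /= An; exists (n - k) => //; rewrite addrC subrK.
Qed.

Lemma mass_opp p (A : set int) :
  mass (fun j => p (- j)) A = mass p [set n | A (- n)].
Proof.
congr fine; symmetry; apply: (@reindex_esum _ _ _ _ _ (fun j => - j)); split.
- by move=> j Aj /=; rewrite opprK.
- by move=> i j _ _ /oppr_inj.
- by move=> n /= An; exists (- n) => //; rewrite opprK.
Qed.

Lemma is_pmf_opp p : is_pmf p -> is_pmf (fun n => p (- n)).
Proof. by move=> [p0 p1]; split=> [//|]; rewrite -p1 [RHS]esum_opp. Qed.

Lemma mass_tight q (e : R) : is_pmf q -> 0 < e ->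
  exists N : nat, 1 - e < mass q [set n | (`|n| <= N)%N].
Proof.
move=> pq e0.
have : ((1 - e)%:E < \esum_(i in setT) (q i)%:E)%E.
  by rewrite (proj2 pq) lte_fin ltrBlDr ltrDl.
move=> /ereal_sup_gt[_ [X [finX _] <-]].
rewrite -esum_fset//; last by move=> i _; exact: is_pmf_ge0e.
rewrite -massE// lte_fin => eX.
exists (\max_(i <- finmap.enum_fset (fset_set X)) `|i|)%N; apply: lt_le_trans eX _; apply: le_mass => //.
move=> n Xn /=; apply: (@leq_bigmax_seq _ _ xpredT (fun i : int => `|i|%N)) => //.
by have := in_fset_set finX n; rewrite mem_set.
Qed.

(** Tightness gives a starting point [- N1] with mass less than [al] strictly below it, and a point
    where the upward search must have succeeded; the least success is the quantile. *)
Lemma quantile_exists q (al : R) : is_pmf q -> 0 < al < 1 ->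
  exists a : int, al <= mass q [set n | n <= a] /\ mass q [set n | n < a] < al.
Proof.
move=> pq /andP[al0 al1].
have [N1 hN1] := mass_tight pq al0.
have [N2 hN2] : exists N : nat, 1 - (1 - al) < mass q [set n | (`|n| <= N)%N].
  by apply: mass_tight => //; lra.
have lo : mass q [set n | n < - N1%:Z] < al.
  apply: (@le_lt_trans _ _ (mass q (~` [set n | (`|n| <= N1)%N]))).
    by apply: le_mass => // n /= nN1 nN1'; lia.
  by rewrite massC//; lra.
have exP : exists k, al <= mass q [set n | n <= - N1%:Z + k%:Z].
  exists (N1 + N2)%N; apply: (@le_trans _ _ (mass q [set n | (`|n| <= N2)%N])); first by lra.
  by apply: le_mass => // n /= nN; lia.
have [k hk mink] := ex_minnP exP.
exists (- N1%:Z + k%:Z); split => //.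
case: k hk mink => [_ _|k hk mink]; first by rewrite addr0.
rewrite ltNge; apply/negP => hlt.
suff /mink : al <= mass q [set n | n <= - N1%:Z + k%:Z] by lia.
by apply: le_trans hlt _; apply: le_mass => // n /= nN; lia.
Qed.

(** [u] comes from the quantile of the reflected law. Both open tails weigh less than [b / 2], so
    what they leave uncovered weighs more than [1 - b]; if [u <= l], that would be the single atom
    [l]. *)
Lemma quantiles q (b : R) : is_pmf q -> 0 < b <= 1 / 4 ->
  (forall k, q k <= 1 - b) ->
  exists l u : int, [/\ l < u, b / 2 <= mass q [set n | n <= l],
    b / 2 <= mass q [set n | u <= n] & 3 / 4 <= mass q [set n | l <= n <= u]].
Proof.
move=> pq /andP[b0 b4] qb.
have b2 : 0 < b / 2 < 1 by lra.
have [l [hl1 hl2]] := quantile_exists pq b2.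
have [u [hu1 hu2]] := quantile_exists (is_pmf_opp pq) b2.
rewrite !mass_opp in hu1 hu2.
have hu3 : b / 2 <= mass q [set n | - u <= n].
  by apply: le_trans hu1 _; apply: le_mass => // n /=; lia.
have hu4 : mass q [set n | - u < n] < b / 2.
  by apply: le_lt_trans hu2; apply: le_mass => // n /=; lia.
have outer A : setT `<=` [set n | n < l] `|` [set n | - u < n] `|` A ->
    1 - b < mass q A.
  move=> cov; have := le_mass pq cov; rewrite massT// => le1.
  have := le_massU pq ([set n | n < l] `|` [set n | - u < n]) A.
  have := le_massU pq [set n | n < l] [set n | - u < n].
  lra.
exists l, (- u); split => //.
- have [//|ul] := ltP l (- u); exfalso.
  have : 1 - b < mass q [set l].
    apply: outer => n _.
    have [nl|nl] := ltP n l; first by left; left.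
    have [nu|nu] := ltP (- u) n; first by left; right.
    by right; rewrite /=; lia.
  by rewrite mass1// ltNge qb.
- apply: (@le_trans _ _ (1 - b)); first lra.
  apply/ltW/outer => n _.
  have [nl|nl] := ltP n l; first by left; left.
  have [nu|nu] := ltP (- u) n; first by left; right.
  by right; rewrite /= nl nu.
Qed.

Lemma conv_ent_spread p q r (hp hq b : R) :
  is_pmf p -> is_pmf q -> is_conv p q r -> ent p = hp%:E -> ent q = hq%:E ->
  0 < b <= 1 / 4 -> (forall k, q k <= 1 - b) ->
  ((hp + b / 64 / 64)%:E <= ent r)%E \/ ((hq + 1 / 32)%:E <= ent r)%E.
Proof.
move=> pp pq pqr php phq bb qb.
have pr := conv_pmf pp pq pqr.
have [b0 b4] := andP bb.
have [l [u [lu ql qu qlu]]] := quantiles pq bb qb.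
have [[t ht]|] := pselect (exists t, 1 / 8 <=
    mass p [set j | j <= t - l] - mass p [set j | j <= t - u]).
  left; have -> : b / 64 / 64 = (b / 2) * (1 / 16) ^+ 2 / 8 by field.
  (* These half-lines follow the shift, so all of them have the same mass [rt] under the shifted
     [r]. For [i <= l] their [p]-mass is at least that of [j <= t - l], for [i >= u] at most that of
     [j <= t - u]. These two masses differ by at least 1/8, so one of them is 1/16 away from
     [rt]. *)
  pose A (i : int) := [set j : int | i + j <= t].
  pose rt := mass r [set n | n <= t].
  have rA i : mass (fun j => r (i + j)) (A i) = rt.
    rewrite mass_shift; congr mass; apply/seteqP.
    by split=> n; rewrite /A /= addrC subrK.
  have [hl|hl] := leP (1 / 16) (mass p [set j | j <= t - l] - rt).
    apply: (@conv_ent_gain _ p q r pp pq pqr hp _ _ [set n | n <= l]) => // i /= il.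
    exists (A i); rewrite rA.
    have : mass p [set j | j <= t - l] <= mass p (A i).
      by apply: le_mass => // j /=; rewrite /A /=; lia.
    nra.
  apply: (@conv_ent_gain _ p q r pp pq pqr hp _ _ [set n | u <= n]) => // i /= il.
  exists (A i); rewrite rA.
  have : mass p (A i) <= mass p [set j | j <= t - u].
    by apply: le_mass => // j /=; rewrite /A /=; lia.
  nra.
move=> /forallNP small; right.
have int_small (t : int) : mass p [set j | t - u < j <= t - l] <= 1 / 8.
  have := small t; rewrite (massID pp [set j | j <= t - l] [set j | j <= t - u]).
  have -> : [set j | j <= t - l] `&` [set j | j <= t - u] = [set j | j <= t - u].
    by apply/seteqP; split=> j /=; lia.
  have -> : [set j | j <= t - l] `&` ~` [set j | j <= t - u] =
            [set j | t - u < j <= t - l].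
    by apply/seteqP; split=> j /=; lia.
  by rewrite addrAC subrr add0r => /negP; rewrite -ltNge => /ltW.
pose A := [set n | l <= n <= u].
have pA m : mass (fun k => p (m + k)) A <= 1 / 4.
  rewrite mass_shift.
  (* The closed interval has one point more than a half-open window of length [u - l], so two
     adjacent windows are used: one ends at [u + m - 1] and the next begins at [u + m]. *)
  have := int_small (l + u + m - 1); have := int_small (u + u + m - 1).
  set B2 := [set j | _]; set B1 := [set j | _] => hB2 hB1.
  apply: (@le_trans _ _ (mass p (B1 `|` B2))).
    apply: le_mass => // n /=; rewrite /A /B1 /B2 /= => nlu.
    by rewrite /setU/=; lia.
  have := le_massU pp B1 B2; lra.
have rA := conv_mass_le pp pq pqr pA.
(* The factor 1/4 is the square of 3/4 - 1/4, the least difference between the masses of [A] under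
   [q] and under a shift of [r]. *)
have -> : 1 / 32 = 1 * (1 / 4) / 8 :> R by field.
apply: (@conv_ent_gain _ q p r pq pp (is_convC pqr) hq _ _ setT) => //.
  by rewrite massT.
move=> i _; exists A; have := rA i; rewrite -/A in qlu; nra.
Qed.

End spread.

(** * The unconditional entropy gap *)

Section gap.
Context (R : realType).

(* Chosen so that the binary entropy lost by conditioning on an atom, at most
   [2 * sqrt (atom_gap c)], is at most [c / 4]. *)
Definition atom_gap (c : R) : R := Num.min (1 / 4) (c ^+ 2 / 64).

(** The smaller of the gains over the mean entropy in the two cases. The gain [b / 64 / 64] without
    a heavy atom is over only one of the two entropies, hence is halved. *)
Definition conv_gap (c : R) : R := Num.min (c / 2) (atom_gap c / 64 / 128).

Lemma atom_gap_bounds (c : R) : 0 < c -> 0 < atom_gap c <= 1 / 4.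
Proof.
move=> c0; rewrite ge_min lexx/= andbT lt_min divr_gt0//=.
by rewrite divr_gt0// exprn_gt0.
Qed.

Lemma conv_gap_gt0 (c : R) : 0 < c -> 0 < conv_gap c.
Proof.
move=> c0; have /andP[a0 _] := atom_gap_bounds c0.
by rewrite lt_min !divr_gt0.
Qed.

Lemma le_conv_gap (c c' : R) : 0 <= c -> c <= c' -> conv_gap c <= conv_gap c'.
Proof.
move=> c0 cc'; apply: le_min2; first by rewrite ler_pM2r.
do 2 apply: ler_wpM2r => //; apply: le_min2 => //; apply: ler_wpM2r => //.
by rewrite lerXn2r ?nnegrE// (le_trans c0).
Qed.

Theorem conv_ent_gap (p q r : int -> R) (hp hq c : R) :
  is_pmf p -> is_pmf q -> is_conv p q r -> ent p = hp%:E -> ent q = hq%:E ->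
  0 < c -> c <= hp -> c <= hq ->
  (((hp + hq) / 2 + conv_gap c)%:E <= ent r)%E.
Proof.
move=> pp pq pqr php phq c0 chp chq.
have := atom_gap_bounds c0; set b := atom_gap c => bb; have [b0 b4] := andP bb.
have [[k qk]|] := pselect (exists k, 1 - b < q k).
  have := conv_ent_concentrated k pp pq pqr php phq.
  have sc : 2 * Num.sqrt (1 - q k) <= c / 4.
    have : Num.sqrt (1 - q k) <= Num.sqrt ((c / 8) ^+ 2).
      rewrite ler_wsqrtr//; apply: (@le_trans _ _ b); first lra.
      rewrite /b /atom_gap ge_min; apply/orP; right; lra.
    rewrite sqrtr_sqr ger0_norm; lra.
  rewrite -leeBlDr// -EFinB; apply: le_trans; rewrite lee_fin.
  have : conv_gap c <= c / 2 by rewrite ge_min lexx.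
  (* Since [q k >= 3 / 4], the surplus over the mean is at least [hp / 4 + hq / 2 - c / 4], hence at
     least [c / 2]. *)
  have := is_pmf_le1 pq k; nra.
move=> /forallNP nk; have qb k : q k <= 1 - b by rewrite leNgt; apply/negP/nk.
have gp : conv_gap c <= b / 64 / 128 by rewrite ge_min lexx orbT.
have := conv_ent_spread pp pq pqr php phq bb qb.
have := conv_ent_ge pp pq pqr php; have := conv_ent_ge pq pp (is_convC pqr) phq.
case: (ent r) => [x| |]; rewrite ?lee_fin ?leey//=.
lra.
Qed.

End gap.

(** * From nats to bits *)

Section bits.
Context (R : realType).

Let ln2_gt0 : 0 < ln 2 :> R. Proof. by rewrite ln_gt0// ltr1n. Qed.

Let entropy_term_ge0 (I : choiceType) (p : I -> R) i : is_pmf p ->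
  (0 <= (- (p i * log2 (p i)))%:E)%E.
Proof.
move=> pp; rewrite lee_fin /log2 mulrA -mulNr divr_ge0 ?(ltW ln2_gt0)//.
by rewrite xent_term_ge0 ?is_pmf_ge0 ?is_pmf_le1.
Qed.

Lemma entropy_pmf_ge0 (I : choiceType) (p : I -> R) : is_pmf p ->
  (0 <= entropy_pmf p)%E.
Proof. by move=> pp; rewrite esum_ge0// => i _; exact: entropy_term_ge0. Qed.

Lemma entropy_pmfE (I : choiceType) (p : I -> R) : is_pmf p ->
  ent p = ((ln 2)%:E * entropy_pmf p)%E.
Proof.
move=> pp; rewrite /entropy_pmf -ge0_esumZl ?ltW//; last first.
  by move=> i; exact: entropy_term_ge0.
apply: eq_esum => i _; rewrite -EFinM /log2; congr EFin; field.
by rewrite gt_eqF.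
Qed.

(* [ent] is in nats, [entropy_pmf] in bits. *)
Definition conv_gap_bits (c : R) : R := conv_gap (ln 2 * c) / ln 2.

Lemma conv_gap0 : conv_gap 0 = 0 :> R.
Proof.
rewrite /conv_gap /atom_gap mul0r expr0n/= mul0r.
have -> : Num.min (1 / 4) 0 = 0 :> R by apply/min_idPr; rewrite divr_ge0.
by rewrite !mul0r minxx.
Qed.

Lemma conv_gap_bits0 : conv_gap_bits 0 = 0.
Proof. by rewrite /conv_gap_bits mulr0 conv_gap0 mul0r. Qed.

Lemma conv_gap_bits_ge0 (c : R) : 0 <= c -> 0 <= conv_gap_bits c.
Proof.
rewrite le_eqVlt => /predU1P[<-|c0]; first by rewrite conv_gap_bits0.
by rewrite divr_ge0 ?ltW// conv_gap_gt0// mulr_gt0.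
Qed.

Lemma conv_gap_bits_gt0 (c : R) : 0 < c -> 0 < conv_gap_bits c.
Proof. by move=> c0; rewrite divr_gt0// conv_gap_gt0// mulr_gt0. Qed.

Lemma le_conv_gap_bits (c c' : R) : 0 <= c -> c <= c' ->
  conv_gap_bits c <= conv_gap_bits c'.
Proof.
move=> c0 cc'; rewrite ler_pM2r ?invr_gt0// le_conv_gap//.
  by rewrite mulr_ge0// ltW.
by rewrite ler_pM2l.
Qed.

Lemma entropy_pmf_conv_ge (p q r : int -> R) (hp : R) :
  is_pmf p -> is_pmf q -> is_conv p q r -> entropy_pmf p = hp%:E ->
  (hp%:E <= entropy_pmf r)%E.
Proof.
move=> pp pq pqr php; have pr := conv_pmf pp pq pqr.
rewrite -(@lee_pmul2l _ (ln 2)%:E)// -entropy_pmfE// -EFinM.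
by apply: (conv_ent_ge pp pq pqr); rewrite entropy_pmfE// php.
Qed.

Lemma entropy_pmf_conv_gap (p q r : int -> R) (hp hq c : R) :
  is_pmf p -> is_pmf q -> is_conv p q r ->
  entropy_pmf p = hp%:E -> entropy_pmf q = hq%:E ->
  0 <= c -> c <= hp -> c <= hq ->
  (((hp + hq) / 2 + conv_gap_bits c)%:E <= entropy_pmf r)%E.
Proof.
move=> pp pq pqr php phq c0 chp chq.
move: c0; rewrite le_eqVlt => /predU1P[<-|c0].
  rewrite conv_gap_bits0 addr0.
  have := entropy_pmf_conv_ge pp pq pqr php.
  have := entropy_pmf_conv_ge pq pp (is_convC pqr) phq.
  case: (entropy_pmf r) => [x| |]; rewrite ?lee_fin ?leey//=; lra.
have pr := conv_pmf pp pq pqr.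
rewrite -(@lee_pmul2l _ (ln 2)%:E)// -entropy_pmfE// -EFinM.
have -> : ln 2 * ((hp + hq) / 2 + conv_gap_bits c) =
    (ln 2 * hp + ln 2 * hq) / 2 + conv_gap (ln 2 * c).
  by rewrite /conv_gap_bits; field; rewrite gt_eqF.
by apply: (conv_ent_gap pp pq pqr); rewrite ?entropy_pmfE ?php ?phq ?mulr_gt0 ?ler_pM2l.
Qed.

End bits.

(** * Averaging the gap over the conditioning values *)

Section averaging.
Context (R : realType) (J : choiceType).
Variables (w h : J -> R) (c : R).
Hypotheses (pw : is_pmf w) (h0 : forall y, 0 <= h y).
Hypothesis mean_h : (\esum_(y in setT) (w y * h y)%:E = c%:E)%E.

Lemma esum_mean_affine (A : set J) (k a b : R) :
  0 <= k -> 0 <= a -> 0 <= a + b ->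
  (\esum_(y in setT) (w y * (k * h y + (a + b * (y \in A)%:R)))%:E =
   (k * c + (a + b * mass w A))%:E)%E.
Proof.
move=> k0 a0 ab0; rewrite EFinD -(esum_affine_indic pw)// EFinM -mean_h.
have w0 y := is_pmf_ge0 pw y.
have whE y : (0 <= (w y * h y)%:E)%E by rewrite lee_fin mulr_ge0.
rewrite -ge0_esumZl// -esumD//.
- by apply: eq_esum => y _; rewrite -EFinM -EFinD; congr EFin; ring.
- by move=> y _; rewrite mule_ge0 ?lee_fin ?mulr_ge0.
- move=> y _; rewrite lee_fin mulr_ge0//.
  by case: (y \in A); rewrite /= ?mulr1 ?mulr0 ?addr0.
Qed.

Lemma mean_ge0 : 0 <= c.
Proof.
by rewrite -lee_fin -mean_h esum_ge0// => y _; rewrite lee_fin mulr_ge0 ?(is_pmf_ge0 pw).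
Qed.

(** The bounds on [F] are asked only at positive weights, because conditioning on a null event does
    not yield a mass function. *)
Lemma mean_gap (F : J -> J -> \bar R) (e : R) :
  0 <= e ->
  (forall y z, 0 < w y -> 0 < w z -> ((h y)%:E <= F y z)%E) ->
  (forall y z, 0 < w y -> 0 < w z -> ((h z)%:E <= F y z)%E) ->
  (forall y z, 0 < w y -> 0 < w z -> c / 2 <= h y -> c / 2 <= h z ->
     (((h y + h z) / 2 + e)%:E <= F y z)%E) ->
  ((c + Num.min (e / 4) (c / 4))%:E <=
   \esum_(y in setT) \esum_(z in setT) (w y * w z)%:E * F y z)%E.
Proof.
move=> e0 hF1 hF2 hF.
have c0 := mean_ge0; have w0 y := is_pmf_ge0 pw y.
pose A := [set y | c / 2 <= h y]; pose a := mass w A.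
have a0 : 0 <= a by exact: mass_ge0.
have a1 : a <= 1 by exact: mass_le1.
(* It suffices to minorize [F] by a real [G] whose inner means [m] are explicit. *)
have iter (G : J -> J -> R) (m : J -> R) :
    (forall y z, 0 < w y -> 0 < w z -> ((G y z)%:E <= F y z)%E) ->
    (forall y z, 0 <= G y z) ->
    (forall y, \esum_(z in setT) (w z * G y z)%:E = (m y)%:E)%E ->
    (\esum_(y in setT) (w y * m y)%:E <=
     \esum_(y in setT) \esum_(z in setT) (w y * w z)%:E * F y z)%E.
  move=> GF G0 Gm; apply: le_esum => y _; rewrite EFinM -Gm.
  rewrite -ge0_esumZl//; last by move=> z; rewrite lee_fin mulr_ge0.
  apply: le_esum => z _.
  have := w0 y; rewrite le_eqVlt => /predU1P[<-|wy]; first by rewrite !mul0r !mul0e.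
  have := w0 z; rewrite le_eqVlt => /predU1P[<-|wz].
    by rewrite mul0r !mulr0 mule0 mul0e.
  rewrite -EFinM mulrA EFinM lee_pmul2l ?lte_fin ?mulr_gt0//.
  exact: GF.
have [ha|ha] := leP (1 / 2) a.
  (* The mean of [h y] and [h z], plus [e] when both lie in [A]; this has probability
     [a * a >= 1 / 4]. *)
  pose G y z := 1 / 2 * h z + (h y / 2 + (e * (y \in A)%:R) * (z \in A)%:R).
  pose m y := 1 / 2 * h y + (c / 2 + (e * a) * (y \in A)%:R).
  apply: (@le_trans _ _ (\esum_(y in setT) (w y * m y)%:E)%E).
    rewrite esum_mean_affine//; [|by rewrite divr_ge0..|by rewrite addr_ge0 ?divr_ge0 ?mulr_ge0].
    rewrite lee_fin -/a.
    have : Num.min (e / 4) (c / 4) <= e / 4 by rewrite ge_min lexx.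
    have : 1 / 4 <= a * a by nra.
    nra.
  apply: (iter G m).
  - move=> y z wy wz; rewrite /G.
    have [/set_mem yA|_] := boolP (y \in A); last first.
      have := hF1 y z wy wz; have := hF2 y z wy wz.
      case: (F y z) => [x| |]; rewrite ?lee_fin ?leey//=; lra.
    have [/set_mem zA|_] := boolP (z \in A); last first.
      have := hF1 y z wy wz; have := hF2 y z wy wz.
      case: (F y z) => [x| |]; rewrite ?lee_fin ?leey//=; lra.
    by apply: le_trans (hF y z wy wz yA zA); rewrite lee_fin/=; lra.
  - move=> y z; rewrite /G !addr_ge0 ?mulr_ge0//.
  - move=> y; rewrite /G esum_mean_affine ?divr_ge0//; last by rewrite addr_ge0 ?divr_ge0 ?mulr_ge0.
    by congr EFin; rewrite /m -/a; ring.
(* Off [A], [h y < c / 2] is replaced by a value of mean [c], a gain of at least [c / 2] on a set of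
   mass more than 1/2. *)
pose G y z := if y \in A then h y else h z.
pose m y := if y \in A then h y else c.
apply: (@le_trans _ _ (\esum_(y in setT) (w y * m y)%:E)%E); last first.
  apply: (iter G m).
  - by move=> y z wy wz; rewrite /G; case: ifP => _; [exact: hF1|exact: hF2].
  - by move=> y z; rewrite /G; case: ifP.
  - move=> y; rewrite /G /m; case: ifP => _ //.
    under eq_esum do rewrite mulrC EFinM.
    by rewrite ge0_esumZl ?(proj2 pw) ?mule1// => z; rewrite lee_fin.
apply: (@le_trans _ _
    (\esum_(y in setT) (w y * (1 * h y + (c / 2 + - (c / 2) * (y \in A)%:R)))%:E)%E).
  rewrite esum_mean_affine//; [|by rewrite divr_ge0|by rewrite subrr].
  rewrite lee_fin -/a.
  have : Num.min (e / 4) (c / 4) <= c / 4 by rewrite ge_min lexx orbT.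
  nra.
apply: le_esum => y _; rewrite lee_fin ler_wpM2l// /m.
have [_|] := boolP (y \in A); rewrite /=; first lra.
rewrite notin_setE /A /= => /negP; rewrite -ltNge; lra.
Qed.

End averaging.

(** * Total probability and conditional laws *)

Section total_probability.
Context d (T : measurableType d) (R : realType) (P : probability T R).

(** Countable additivity along naturals, transported to [I] through the injection [pickle]. *)
Lemma esum_fiber (I : countType) (Z : T -> I) (B : set T) :
  measurable B -> (forall i, measurable (Z @^-1` [set i])) ->
  P B = (\esum_(i in setT) P (B `&` Z @^-1` [set i]))%E.
Proof.
move=> mB mZ; pose F (n : nat) := B `&` [set t | pickle (Z t) = n].
have FE i : F (pickle i) = B `&` Z @^-1` [set i].
  apply/seteqP; split=> t [Bt]; rewrite /= => Zt; split=> //=; last by rewrite Zt.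
  exact: (pcan_inj pickleK).
have -> : B = \bigcup_(n in range (@pickle I)) F n.
  apply/seteqP; split=> [t Bt|t [n _ []//]].
  by exists (pickle (Z t)); [exists (Z t)|split].
rewrite measure_bigcup; last 2 first.
- by move=> n [i _ <-]; rewrite FE; exact: measurableI.
- by move=> m n _ _ [t [[_ /= <-] [_ /= <-]]].
rewrite nneseries_esum; last by move=> n _; exact: measure_ge0.
rewrite set_mem_set esum_image; last by move=> i j _ _ /(pcan_inj pickleK).
apply: eq_esum => i _; congr (P _); rewrite FE.
apply/seteqP; split=> t.
  by move=> [Bt Zt]; split=> //; exists (pickle i); [exists i|rewrite FE].
by move=> [[n _ [Bt _]] Zt]; split.
Qed.

Lemma is_pmf_marginal (I : countType) (Z : T -> I) :
  (forall i, measurable (Z @^-1` [set i])) ->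
  is_pmf (fun i => fine (P (Z @^-1` [set i]))).
Proof.
move=> mZ; split=> [i|]; first exact: fine_ge0.
rewrite -(probability_setT P) (esum_fiber measurableT mZ).
by apply: eq_esum => i _; rewrite setTI fineK// fin_num_measure.
Qed.

Lemma is_pmf_cond (I J : countType) (X : T -> I) (Y : T -> J) (y : J) :
  (forall i, measurable (X @^-1` [set i])) ->
  (forall j, measurable (Y @^-1` [set j])) ->
  0 < fine (P (Y @^-1` [set y])) -> is_pmf (cond_pmf P X Y y).
Proof.
move=> mX mY y0; split=> [i|]; first by rewrite divr_ge0// fine_ge0.
transitivity (\esum_(i in setT) ((fine (P (Y @^-1` [set y])))^-1%:E *
    P (Y @^-1` [set y] `&` X @^-1` [set i])))%E.
  apply: eq_esum => i _; rewrite /cond_pmf mulrC EFinM setIC fineK//.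
  by rewrite fin_num_measure//; exact: measurableI.
rewrite ge0_esumZl ?invr_ge0 ?ltW// -esum_fiber//.
by rewrite -[X in (_ * X)%E]fineK ?fin_num_measure// -EFinM mulVf// gt_eqF.
Qed.

End total_probability.

(** * The conditional law of the sum of two i.i.d. pairs *)

Section iid_pairs.
Context d (T : measurableType d) (R : realType) (P : probability T R).
Variables X Y X' Y' : {RV P >-> int}.
Hypothesis XY_id :
  identically_distributed P (fun t => (X t, Y t)) (fun t => (X' t, Y' t)).
Hypothesis XY_ind :
  independent_rv P (fun t => (X t, Y t)) (fun t => (X' t, Y' t)).

Let w y := fine (P (Y @^-1` [set y])).

Let mRV (Z : {RV P >-> int}) i : measurable (Z @^-1` [set i]).
Proof. exact: measurable_funPTI. Qed.

Let mXY (A B : set int) : measurable (A `*` B).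
Proof. exact: measurableX. Qed.

Let joint_id (A B : set int) :
  P (X' @^-1` A `&` Y' @^-1` B) = P (X @^-1` A `&` Y @^-1` B).
Proof. exact: esym (XY_id (mXY A B)). Qed.

Let joint_ind (A B A' B' : set int) :
  P ((X @^-1` A `&` Y @^-1` B) `&` (X' @^-1` A' `&` Y' @^-1` B')) =
  (P (X @^-1` A `&` Y @^-1` B) * P (X @^-1` A' `&` Y @^-1` B'))%E.
Proof. by rewrite -(joint_id A' B'); exact: (XY_ind (mXY A B) (mXY A' B')). Qed.

Let pair_fiber y z :
  (fun t => (Y t, Y' t)) @^-1` [set (y, z)] = Y @^-1` [set y] `&` Y' @^-1` [set z].
Proof. by apply/seteqP; split=> t; [case=> <- <-|case=> /= -> ->]. Qed.

Lemma prob_pair_fiber y z :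
  P ((fun t => (Y t, Y' t)) @^-1` [set (y, z)]) = (w y * w z)%:E.
Proof.
rewrite pair_fiber; have := joint_ind setT [set y] setT [set z].
by rewrite !preimage_setT !setTI => ->; rewrite EFinM !fineK// fin_num_measure.
Qed.

(** Split the event by the value of [X']; independence factors each piece, and equality of laws
    removes the primes. *)
Lemma cond_pmf_sum y z : 0 < w y -> 0 < w z ->
  is_conv (cond_pmf P X Y y) (cond_pmf P X Y z)
    (cond_pmf P (fun t => X t + X' t) (fun t => (Y t, Y' t)) (y, z)).
Proof.
move=> wy wz n; rewrite {1}/cond_pmf prob_pair_fiber /=.
have mS : measurable ((fun t => X t + X' t) @^-1` [set n] `&`
    (fun t => (Y t, Y' t)) @^-1` [set (y, z)]).
  rewrite pair_fiber; apply: measurableI; last exact: measurableI.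
  have -> : (fun t => X t + X' t) @^-1` [set n] =
      \bigcup_(i in [set: int]) (X @^-1` [set n - i] `&` X' @^-1` [set i]).
    apply/seteqP; split=> t /=.
      by move=> <-; exists (X' t) => //; split=> //=; rewrite addrK.
    by move=> [i _ [/= -> ->]]; rewrite subrK.
  by apply: countable_bigcupT_measurable => // i; exact: measurableI.
rewrite mulrC EFinM fineK ?fin_num_measure//.
rewrite (esum_fiber P mS (mRV X')) -ge0_esumZl//; last by rewrite invr_ge0 mulr_ge0// ltW.
apply: eq_esum => i _.
have -> : (fun t => X t + X' t) @^-1` [set n] `&`
    (fun t => (Y t, Y' t)) @^-1` [set (y, z)] `&` X' @^-1` [set i] =
    (X @^-1` [set n - i] `&` Y @^-1` [set y]) `&`
    (X' @^-1` [set i] `&` Y' @^-1` [set z]).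
  rewrite pair_fiber; apply/seteqP; split=> t /=.
    by move=> [[<- [-> ->]] <-]; rewrite addrK.
  by move=> [[-> ->] [-> ->]]; rewrite subrK.
rewrite joint_ind /cond_pmf -/(w y) -/(w z).
have fin A B : P (X @^-1` A `&` Y @^-1` B) =
    (fine (P (X @^-1` A `&` Y @^-1` B)))%:E.
  by rewrite fineK// fin_num_measure//; apply: measurableI; exact: measurable_funPTI.
rewrite (fin [set n - i] [set y]) (fin [set i] [set z]) -!EFinM; congr EFin.
by field; rewrite !gt_eqF.
Qed.

End iid_pairs.

(** * The gap for conditional entropies *)

Theorem theorem3 (R : realType) :
  exists g : R -> R,
    (forall c, 0 <= c -> 0 <= g c) /\
    (forall (d : measure_display) (T : measurableType d) (P : probability T R)
        (X Y X' Y' : {RV P >-> int}),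
      identically_distributed P (fun t => (X t, Y t)) (fun t => (X' t, Y' t)) ->
      independent_rv P (fun t => (X t, Y t)) (fun t => (X' t, Y' t)) ->
      (cond_entropy P X Y < +oo)%E ->
      (cond_entropy P (fun t => (X t + X' t)%R) (fun t => (Y t, Y' t))
         - cond_entropy P X Y
       >= (g (fine (cond_entropy P X Y)))%:E)%E) /\
    (forall c c', 0 <= c -> c <= c' -> g c <= g c') /\
    (forall c, 0 <= c -> (g c = 0 <-> c = 0)).
Proof.
(* The gain of [mean_gap] with [e = conv_gap_bits (c / 2)], the gap being applied only where both
   entropies are at least [c / 2]. *)
pose g (c : R) := Num.min (conv_gap_bits (c / 2) / 4) (c / 4).
have g0 : g 0 = 0 by rewrite /g mul0r conv_gap_bits0 !mul0r minxx.
have g_gt0 c : 0 < c -> 0 < g c.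
  move=> c0; rewrite lt_min (divr_gt0 c0)// andbT (divr_gt0 (conv_gap_bits_gt0 _))//.
  exact: divr_gt0.
have g_mono c c' : 0 <= c -> c <= c' -> g c <= g c'.
  move=> c0 cc'; apply: le_min2; last by rewrite ler_pM2r.
  rewrite ler_pM2r// le_conv_gap_bits//; last by rewrite ler_pM2r.
  by rewrite divr_ge0.
exists g; split; last split; last split.
- by move=> c c0; rewrite -g0 g_mono.
- move=> d T P X Y X' Y' XY_id XY_ind fin.
  pose w y := fine (P (Y @^-1` [set y])).
  pose ey y := entropy_pmf (cond_pmf P X Y y).
  have pw : is_pmf w by apply: is_pmf_marginal => y; exact: measurable_funPTI.
  have wE y : P (Y @^-1` [set y]) = (w y)%:E.
    by rewrite fineK// fin_num_measure//; exact: measurable_funPTI.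
  have pc y : 0 < w y -> is_pmf (cond_pmf P X Y y).
    by move=> wy; apply: is_pmf_cond wy => z; exact: measurable_funPTI.
  have w0 y := is_pmf_ge0 pw y.
  have ey0 y : (0 <= (w y)%:E * ey y)%E.
    have := w0 y; rewrite le_eqVlt => /predU1P[<-|wy]; first by rewrite mul0e.
    by rewrite mule_ge0 ?lee_fin// entropy_pmf_ge0//; exact: pc.
  have cE : cond_entropy P X Y = (\esum_(y in setT) (w y)%:E * ey y)%E.
    by apply: eq_esum => y _; rewrite wE.
  (* An infinite entropy at a value of positive probability would make H(X|Y) infinite. *)
  have eyE y : 0 < w y -> ey y = (fine (ey y))%:E.
    move=> wy; rewrite fineK// ge0_fin_numE ?entropy_pmf_ge0//; last exact: pc.
    rewrite ltey; apply/eqP => eyoo; have := @esum_ge1 R _ setT _ y ey0 I.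
    rewrite -cE eyoo gt0_muley ?lte_fin// leye_eq => /eqP coo.
    by rewrite coo ltxx in fin.
  set c := fine _.
  have cfin : cond_entropy P X Y = c%:E.
    by rewrite fineK// ge0_fin_numE// cE esum_ge0.
  (* The value 0 at null [y] keeps [h] nonnegative everywhere and leaves the weighted mean
     unchanged. *)
  pose h y := if 0 < w y then fine (ey y) else 0.
  have h0 y : 0 <= h y.
    by rewrite /h; case: ifP => // wy; rewrite fine_ge0// entropy_pmf_ge0//; exact: pc.
  have mh : (\esum_(y in setT) (w y * h y)%:E = c%:E)%E.
    rewrite -cfin cE; apply: eq_esum => y _; rewrite /h; case: ifPn => [wy|].
      by rewrite EFinM -eyE.
    by rewrite -leNgt => wy; rewrite (@le_anti _ _ (w y) 0) ?wy ?w0// mul0r mul0e.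
  have hE y : 0 < w y -> entropy_pmf (cond_pmf P X Y y) = (h y)%:E.
    by move=> wy; rewrite /h wy -eyE.
  rewrite cfin leeBrDr// addrC -EFinD.
  have -> : cond_entropy P (fun t => X t + X' t) (fun t => (Y t, Y' t)) =
      (\esum_(y in setT) \esum_(z in setT) (w y * w z)%:E *
        entropy_pmf (cond_pmf P (fun t => (X t + X' t)%R) (fun t => (Y t, Y' t)) (y, z)))%E.
    rewrite esum_esum; last first.
      move=> y z _ _.
      have := w0 y; rewrite le_eqVlt => /predU1P[<-|wy]; first by rewrite mul0r mul0e.
      have := w0 z; rewrite le_eqVlt => /predU1P[<-|wz]; first by rewrite mulr0 mul0e.
      rewrite mule_ge0 ?lee_fin ?mulr_ge0// entropy_pmf_ge0//.
      exact: conv_pmf (pc y wy) (pc z wz) (cond_pmf_sum XY_id XY_ind wy wz).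
    have -> : [set: int] `*`` (fun=> [set: int]) = [set: int * int].
      by apply/seteqP; split.
    by apply: eq_esum => -[y z] _; rewrite (prob_pair_fiber XY_id XY_ind).
  apply: (mean_gap pw h0 mh) => //.
  + by rewrite conv_gap_bits_ge0// divr_ge0// (mean_ge0 pw h0 mh).
  + move=> y z wy wz; apply: (entropy_pmf_conv_ge (pc y wy) (pc z wz)); last exact: hE.
    exact: cond_pmf_sum.
  + move=> y z wy wz; apply: (entropy_pmf_conv_ge (pc z wz) (pc y wy)); last exact: hE.
    exact/is_convC/cond_pmf_sum.
  + move=> y z wy wz cy cz.
    apply: (entropy_pmf_conv_gap (pc y wy) (pc z wz)); rewrite ?hE//.
      exact: cond_pmf_sum.
    by rewrite divr_ge0// (mean_ge0 pw h0 mh).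
- exact: g_mono.
- move=> c c0; split=> [gc|->//]; move: c0; rewrite le_eqVlt => /predU1P[//|/g_gt0].
  by rewrite gc ltxx.
Qed.
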